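(* Let $\kappa$ be a regular uncountable cardinal, $\sigma<\omega\le\nu<\kappa$ cardinals, $\xi\le\kappa$, and $S\subseteq E^\kappa_{>\nu}$ stationary. Let $\vec J=\langle J_\delta\mid\delta\in S\rangle$ where each $J_\delta$ is a $\mathrm{cf}(\delta)$-additive proper ideal over $\delta$ extending $J^{\mathrm{bd}}[\delta]$. Suppose $\vec C=\langle C_\delta\mid\delta\in S\rangle$ witnesses $\mathrm{CG}_\xi(S,E^\kappa_{\le\nu},1,\vec J)$. Then there exists a postprocessing$^*$ function $\Phi:\mathcal K(\kappa)\to\mathcal K(\kappa)$ such that $\langle\Phi(C_\delta)\mid\delta\in S\rangle$ witnesses $\mathrm{CG}_\xi(S,\kappa,\sigma,\vec J)$.
   Context: For a set of ordinals $A$: $\mathrm{ssup}(A)=\sup\{\alpha+1\mid\alpha\in A\}$, $\mathrm{acc}^+(A)=\{\alpha<\mathrm{ssup}(A)\mid\sup(A\cap\alpha)=\alpha>0\}$, $\mathrm{acc}(A)=A\cap\mathrm{acc}^+(A)$. $E^\kappa_{>\nu}=\{\alpha<\kappa\mid\mathrm{cf}(\alpha)>\nu\}$, $E^\kappa_{\le\nu}$ analogously. A $C$-sequence over $S$ is $\langle C_\delta\mid\delta\in S\rangle$ with each $C_\delta$ a closed subset of $\delta$ with $\sup(C_\delta)=\delta$; $\xi$-bounded means $\mathrm{otp}(C_\delta)\le\xi$. $\mathrm{suc}_\sigma(C)=\{C(j+1)\mid j<\sigma,\ j+1<\mathrm{otp}(C)\}$, $C(i)$ the $i$-th element of $C$.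 $J^{\mathrm{bd}}[\delta]$ is the ideal of bounded subsets of $\delta$; $J^+=\mathcal P(\delta)\setminus J$. For $T\subseteq\kappa$ (here $T$ may be $\kappa$ or $E^\kappa_{\le\nu}$) and an ordinal $\sigma$, $\mathrm{CG}_\xi(S,T,\sigma,\vec J)$ asserts the existence of a $\xi$-bounded $C$-sequence $\langle C_\delta\mid\delta\in S\rangle$ such that for every club $D\subseteq\kappa$ there is $\delta\in S$ with $\{\beta<\delta\mid\mathrm{suc}_\sigma(C_\delta\setminus\beta)\subseteq D\cap T\}\in J_\delta^+$. $\mathcal K(\kappa)=\{x\subseteq\kappa\mid x\ne\emptyset,\ \mathrm{acc}^+(x)\subseteq x,\ \sup(x)\notin x\}$. For $\bar x,x\in\mathcal K(\kappa)$, $\bar x\sqsubseteq^* x$ means $\sup(\bar x\triangle(x\cap\sup(\bar x)))<\sup(\bar x)$. A map $\Phi:\mathcal K(\kappa)\to\mathcal K(\kappa)$ is a postprocessing$^*$ function if for every $x\in\mathcal K(\kappa)$: (i) $\Phi(x)$ is club in $\sup(x)$; (ii) $\mathrm{acc}(\Phi(x))\subseteq\mathrm{acc}(x)$; (iii) $\Phi(x)\cap\bar\alpha=\Phi(x\cap\bar\alpha)$ for every $\bar\alpha\in\mathrm{acc}(\Phi(x))$; (iv) for every $\bar x\in\mathcal K(\kappa)$ with $\bar x\sqsubseteq^*x$ and $\sup(\bar x)\in\mathrm{acc}(\Phi(x))$, $\Phi(\bar x)\sqsubseteq^*\Phi(x)$. *)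

(* Defs.v *)
From mathcomp Require Import all_boot all_order.
From mathcomp Require Import boolp classical_sets functions cardinality.
From mathcomp Require wochoice.

Set Implicit Arguments.
Unset Strict Implicit.
Unset Printing Implicit Defensive.

Local Open Scope order_scope.
Local Open Scope card_scope.
Local Open Scope classical_set_scope.

(* The cardinal kappa is a well-ordered type K: its elements are the ordinals
   below kappa, and a subset of kappa is a [set K].  As for von Neumann
   ordinals, an ordinal X <= kappa is also identified with the set of its
   elements, an initial segment of K ([is_ordinal X]); thus kappa is [setT], the
   element a of K is [below a], X <= Y is [X `<=` Y] and X < Y is [X `<` Y].
   Suprema, order types and cofinalities, which may be equal to kappa, are
   given in this form. *)

Section Ordinals.
Context {d : Order.disp_t} {K : orderType d}.
Implicit Types (a b c i j : K) (A B C D S T X xi sigma : set K).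

Definition below a : set K := [set b | b < a].

Definition is_ordinal X : Prop := forall a b, b <= a -> X a -> X b.

(* X \in A, for an ordinal X <= kappa and A a subset of kappa *)
Definition ord_mem X A : Prop := exists2 a, A a & X = below a.

Definition ord_one : set K := [set a | forall b, a <= b].

Definition omega : set K := [set a | finite_set (below a)].

Definition is_succ a b : Prop := a < b /\ forall c, a < c -> b <= c.

(* The union of the a in A, which as a set of ordinals is their supremum. *)
Definition osup A : set K := [set b | exists2 a, A a & b < a].

Definition ssup A : set K := [set b | exists2 a, A a & b <= a].

Definition order_iso A B : Prop :=
  exists f : K -> K, set_bij A B f /\
    forall a b, A a -> A b -> a < b -> f a < f b.

(* c = A(i), the i-th element of A *)
Definition nth_elt A i c : Prop := A c /\ order_iso (below i) (A `&` below c).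

Definition otp A : set K := [set i | exists c, nth_elt A i c].

Definition cofinal_in X A : Prop :=
  A `<=` X /\ forall b, X b -> exists2 a, A a & b <= a.

(* cf(X), the least order type of a cofinal subset of X (the intersection of a
   nonempty family of ordinals is its minimum) *)
Definition cof X : set K := [set i | forall A, cofinal_in X A -> otp A i].

Definition is_cardinal X : Prop :=
  is_ordinal X /\ forall a, X a -> ~ (X #<= below a).

Definition E_gt nu : set K := [set a | below nu `<` cof (below a)].

Definition E_le nu : set K := [set a | cof (below a) `<=` below nu].

Definition accp A : set K :=
  [set a | [/\ ssup A a, osup (A `&` below a) = below a & below a !=set0]].

Definition acc A : set K := A `&` accp A.

Definition closed_in X A : Prop :=
  A `<=` X /\
  forall a, X a -> osup (A `&` below a) = below a -> below a !=set0 -> A a.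

Definition club_in X A : Prop := closed_in X A /\ osup A = X.

Definition stationary S : Prop :=
  forall D, club_in [set: K] D -> (S `&` D) !=set0.

Definition C_sequence S (C : K -> set K) : Prop :=
  forall delta, S delta -> club_in (below delta) (C delta).

Definition bounded_seq xi S (C : K -> set K) : Prop :=
  forall delta, S delta -> otp (C delta) `<=` xi.

(* suc_sigma(C) = {C(j+1) | j < sigma, j+1 < otp(C)} *)
Definition suc sigma C : set K :=
  [set c | exists j j', [/\ sigma j, is_succ j j', otp C j' & nth_elt C j' c]].

Definition Jbd a : set (set K) :=
  [set A | A `<=` below a /\ exists2 b, b < a & A `<=` below b].

Definition proper_ideal X (J : set (set K)) : Prop :=
  [/\ forall A, J A -> A `<=` X,
      J set0,
      forall A B, J B -> A `<=` B -> J A,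
      forall A B, J A -> J B -> J (A `|` B)
    & ~ J X].

(* closed under unions of fewer than theta sets, theta a cardinal *)
Definition additive (theta : set K) (J : set (set K)) : Prop :=
  forall F : set (set K), F `<=` J -> ~ (theta #<= F) ->
    J (\bigcup_(A in F) A).

Definition positive X (J : set (set K)) : set (set K) :=
  [set A | A `<=` X /\ ~ J A].

(* The sequence C witnesses CG_xi(S, T, sigma, J). *)
Definition witnesses_CG xi S T sigma (J : K -> set (set K)) (C : K -> set K) :
    Prop :=
  [/\ C_sequence S C,
      bounded_seq xi S C
    & forall D, club_in [set: K] D ->
      exists2 delta, S delta &
        positive (below delta) (J delta)
          [set b | b < delta /\
                   suc sigma (C delta `\` below b) `<=` D `&` T]].

(* the class \mathcal{K}(kappa) *)
Definition KK : set (set K) :=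
  [set x | [/\ x !=set0, accp x `<=` x & ~ ord_mem (osup x) x]].

(* y \sqsubseteq^* x; the symmetric difference is written out *)
Definition sqsub_star (y x : set K) : Prop :=
  let z := x `&` osup y in
  osup ((y `\` z) `|` (z `\` y)) `<` osup y.

(* Only the values of Phi on KK matter. *)
Definition postprocessing_star (Phi : set K -> set K) : Prop :=
  (forall x, KK x -> KK (Phi x)) /\
  forall x, KK x ->
    [/\ club_in (osup x) (Phi x),
        acc (Phi x) `<=` acc x,
        forall a, acc (Phi x) a -> Phi x `&` below a = Phi (x `&` below a)
      & forall y, KK y -> sqsub_star y x -> ord_mem (osup y) (acc (Phi x)) ->
          sqsub_star (Phi y) (Phi x)].

End Ordinals.

Definition regular_uncountable d (K : orderType d) : Prop :=
  [/\ wochoice.well_order (<=%O : rel K),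
      is_cardinal [set: K],
      cof [set: K] = [set: K]
    & ~ countable [set: K]].

(* Main.v *)
(* For [g] of cofinality at most [nu] fix a cofinal map [e g] from [nu] to [g].
   Given a finite list [s] of indices below [nu] and a club [D], let [Phi x]
   arise from [x] by inserting into every gap of [x] below a point [g] of [x]
   the points [e g z], [z] in [s], that lie in that gap, and by then replacing
   every point [h] by [max (D `&` [0, h])].  Only finitely many points are added
   to each gap, so limit points of [Phi x] are limit points of [x]; hence [Phi]
   is a postprocessing* function and does not increase order types.

   Suppose that no such [Phi] works.  For each [s] iterate the counterexamples
   to a decreasing sequence of clubs [D_i], and let [delta] be the index that
   [C] guesses for the limit points of a club [E] contained in all the [D_i].
   If the second element [g] of [C delta `\` below b] is such a limit point, of
   cofinality at most [nu], some [s] makes the points [e g z] interleaved with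
   [E], so that [Phi (C delta)] has more than [sigma] points between [b] and [g].
   They come from finitely many [h], and for each of these
   [max (D_i `&` [0, h])] decreases with [i] and is thus eventually constant: for
   large [i] all of them belong to [D_(i+1)].  Thus the positive set of all such [b]
   is a union, over the at most [nu] lists [s] and countably many [i], of sets
   that the counterexamples put in [J delta]. *)

Require Import Defs.
From mathcomp Require Import all_boot all_order.
From mathcomp Require Import boolp classical_sets functions cardinality.
From mathcomp Require wochoice.

Set Implicit Arguments.
Unset Strict Implicit.
Unset Printing Implicit Defensive.

Import Order.TTheory.

Local Open Scope order_scope.
Local Open Scope card_scope.
Local Open Scope classical_set_scope.

(** * Well-orders and limit points *)

Definition least_elements d (K : orderType d) : Prop :=
  forall P : set K, P !=set0 -> exists2 m, P m & forall a, P a -> m <= a.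

Lemma well_order_least d (K : orderType d) :
  wochoice.well_order (<=%O : rel K) -> least_elements K.
Proof.
move=> wo P [a Pa].
have [|m [[mP mle] _]] := wo (fun b => `[< P b >]).
  by exists a; rewrite unfold_in; apply/asboolP.
exists m; first by move: mP; rewrite unfold_in => /asboolP.
by move=> b Pb; apply: mle; rewrite unfold_in; apply/asboolP.
Qed.

(** Unlike [accp], this does not require [a] to be below [ssup A], so it also covers the supremum of
    a set without maximum. *)
Definition limit_pt d (K : orderType d) (A : set K) (a : K) : Prop :=
  below a !=set0 /\ forall b, b < a -> exists2 c, A c & b < c < a.

Lemma limit_ptE d (K : orderType d) (A : set K) (a : K) :
  limit_pt A a <-> osup (A `&` below a) = below a /\ below a !=set0.
Proof.
split=> [[ne lim]|[eq ne]]; split=> //.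
  apply/seteqP; split=> [b [c [_ ca] bc]|b ba]; first exact: lt_trans ca.
  by have [c Ac /andP[bc ca]] := lim _ ba; exists c.
move=> b ba; have [c [Ac ca] bc] : osup (A `&` below a) b by rewrite eq.
by exists c => //; apply/andP.
Qed.

Lemma limit_pt_sub d (K : orderType d) (A B : set K) (a : K) :
  (forall b, b < a -> A b -> B b) -> limit_pt A a -> limit_pt B a.
Proof.
move=> AB [ne lim]; split=> // b /lim[c Ac /andP[bc ca]].
by exists c; [exact: AB|rewrite bc ca].
Qed.

Lemma closed_inE d (K : orderType d) (X A : set K) :
  closed_in X A <->
  A `<=` X /\ forall a, X a -> limit_pt A a -> A a.
Proof.
split=> -[AX cl]; split=> // a Xa.
  by move=> /limit_ptE[]; exact: cl.
by move=> eq ne; apply: cl => //; apply/limit_ptE.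
Qed.

Lemma osup_ordinal d (K : orderType d) (A : set K) : is_ordinal (osup A).
Proof. by move=> a b ba [c Ac ac]; exists c => //; exact: le_lt_trans ac. Qed.

(** * Ranks and order types *)

Section WellOrder.
Context {d : Order.disp_t} {K : orderType d} (wo : least_elements K).
Implicit Types (a b c i j : K) (A B X L : set K).

Lemma lt_wf : well_founded (fun a b : K => a < b).
Proof.
move=> a; apply: contrapT => na.
have [|m nm mle] := wo (P := [set b | ~ Acc (fun a b : K => a < b) b]).
  by exists a.
apply: nm; constructor=> b bm; apply: contrapT => /mle.
by rewrite leNgt bm.
Qed.

Lemma lt_ind_on (P : K -> Prop) :
  (forall c, (forall a, a < c -> P a) -> P c) -> forall c, P c.
Proof. exact: (well_founded_ind lt_wf). Qed.

Definition least_strict_ub (P : set K) : set K :=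
  [set i | (forall j, P j -> j < i) /\
           forall i', (forall j, P j -> j < i') -> i <= i'].

Definition rank A : K -> K :=
  Fix lt_wf (fun=> K) (fun c f =>
    xget c (least_strict_ub
      [set j | exists a (ac : a < c), A a /\ j = f a ac])).

Lemma rankE A c :
  rank A c = xget c (least_strict_ub (rank A @` (A `&` below c))).
Proof.
rewrite {1}/rank Fix_eq.
  congr (xget _ (least_strict_ub _)); apply/seteqP; split=> j.
    by move=> [a [ac [Aa ->]]]; exists a.
  by move=> [a [Aa ac] <-]; exists a, ac.
move=> x f g fg; congr (xget _ (least_strict_ub _)).
by apply/seteqP; split=> j [a [ac [Aa ->]]]; exists a, ac; rewrite fg.
Qed.

(** The two claims need each other: if earlier ranks do not exceed their arguments, [c] is a strict
    upper bound of them, so a least one exists. *)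
Lemma rank_spec A c :
  least_strict_ub (rank A @` (A `&` below c)) (rank A c) /\ rank A c <= c.
Proof.
elim/lt_ind_on: c => c IH.
have cub j : (rank A @` (A `&` below c)) j -> j < c.
  by move=> [a [_ ac] <-]; have [_ ra] := IH _ ac; exact: le_lt_trans ac.
have [|m mub mle] :=
    wo (P := [set i | forall j, (rank A @` (A `&` below c)) j -> j < i]).
  by exists c.
have spec : least_strict_ub (rank A @` (A `&` below c)) (rank A c).
  by rewrite rankE; apply: xgetPex; exists m; split.
by split=> //; apply: spec.2.
Qed.

Lemma rank_lt A a c : A a -> a < c -> rank A a < rank A c.
Proof. by move=> Aa ac; apply: (rank_spec A c).1.1; exists a. Qed.

Lemma rank_le A c i :
  (forall a, A a -> a < c -> rank A a < i) -> rank A c <= i.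
Proof.
by move=> H; apply: (rank_spec A c).1.2 => j [a [Aa ac] <-]; exact: H.
Qed.

Lemma rank_mono A a c : a <= c -> rank A a <= rank A c.
Proof.
by move=> ac; apply: rank_le => b Ab ba; apply: rank_lt => //; exact: lt_le_trans ac.
Qed.

Lemma rank_lt_inv A a c : rank A a < rank A c -> a < c.
Proof. by move=> h; rewrite ltNge; apply/negP => /(rank_mono A); rewrite leNgt h. Qed.

Lemma rank_inj A a c : A a -> A c -> rank A a = rank A c -> a = c.
Proof.
move=> Aa Ac eq; case: (ltgtP a c) => // [/(rank_lt Aa)|/(rank_lt Ac)];
  by rewrite eq ltxx.
Qed.

Lemma rank_surj A c i : i < rank A c -> exists a, [/\ A a, a < c & rank A a = i].
Proof.
elim/lt_ind_on: c i => c IH i ic.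
have [a [Aa ac ia]] : exists a, [/\ A a, a < c & i <= rank A a].
  apply: contrapT => nex; move: ic; rewrite ltNge => /negP; apply.
  apply: rank_le => a Aa ac; rewrite ltNge; apply/negP => ia.
  by apply: nex; exists a.
move: ia; rewrite le_eqVlt => /orP[/eqP->|ia]; first by exists a.
by have [b [Ab ba <-]] := IH _ ac _ ia; exists b; split=> //; exact: lt_trans ac.
Qed.

(** By induction, an isomorphism of [below i] onto the part of [A] below [c] is inverse to
    [rank A]. *)
Lemma nth_eltE A i c : nth_elt A i c <-> A c /\ rank A c = i.
Proof.
split=> [[Ac [f [[fto finj fsurj] fmono]]]|[Ac <-]]; split=> //.
  have fmono' j k : j < i -> k < i -> f j < f k -> j < k.
    move=> ji ki; rewrite !ltNge => /negP h; apply/negP => kj; apply: h.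
    by move: kj; rewrite le_eqVlt => /orP[/eqP->//|/fmono h]; apply/ltW/h.
  have rf j : j < i -> rank A (f j) = j.
    elim/lt_ind_on: j => j IH ji; apply/eqP; rewrite eq_le; apply/andP; split.
      apply: rank_le => a Aa afj.
      have [k ki fk] : (f @` below i) a.
        by apply: fsurj; split=> //; apply: lt_trans afj _; case: (fto _ ji).
      have kj : k < j by apply: fmono' => //; rewrite fk.
      by rewrite -fk IH.
    rewrite leNgt; apply/negP => h; have hi := lt_trans h ji.
    have := fmono _ _ hi ji h; have [Afj _] := fto _ hi.
    by move=> /(rank_lt Afj); rewrite (IH _ h hi) ltxx.
  apply/eqP; rewrite eq_le; apply/andP; split.
    apply: rank_le => a Aa ac.
    have [k ki <-] : (f @` below i) a by apply: fsurj.
    by rewrite rf.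
  rewrite leNgt; apply/negP => h; have [Af fc] := fto _ h.
  by have := rank_lt Af fc; rewrite (rf _ h) ltxx.
have /choice[f fP] : forall j, exists a, j < rank A c ->
    [/\ A a, a < c & rank A a = j].
  move=> j; have [/rank_surj[a aP]|nj] := pselect (j < rank A c).
    by exists a.
  by exists c.
exists f; split; first split.
- by move=> j /fP[].
- move=> j k; rewrite !inE => /fP[_ _ fj] /fP[_ _ fk] eq.
  by rewrite -fj -fk eq.
- move=> a [Aa ac]; have rac := rank_lt Aa ac; exists (rank A a) => //.
  by have [Af _ rf] := fP _ rac; exact: rank_inj rf.
- move=> j k /fP[_ _ fj] /fP[_ _ fk] jk; apply: (@rank_lt_inv A).
  by rewrite fj fk.
Qed.

Lemma otpE A : otp A = rank A @` A.
Proof.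
apply/seteqP; split=> i.
  by move=> [c /nth_eltE[Ac rc]]; exists c.
by move=> [c Ac rc]; exists c; apply/nth_eltE.
Qed.

Lemma otp_ordinal A : is_ordinal (otp A).
Proof.
move=> a b ba; rewrite otpE => -[c Ac rc].
move: ba; rewrite le_eqVlt => /orP[/eqP->|]; first by exists c.
by rewrite -rc => /rank_surj[e [Ae _ re]]; exists e.
Qed.

(** The supremum of a set without maximum is not attained; [u] guarantees that it exists in [K]. *)
Lemma lub_limit A b :
  A b -> (forall a, A a -> exists2 a', A a' & a < a') ->
  forall u, (forall a, A a -> a <= u) ->
  exists l, [/\ l <= u, limit_pt A l & forall a, A a -> a < l].
Proof.
move=> Ab nomax u uub.
have [|l lub lle] := wo (P := [set l | forall a, A a -> a <= l]).
  by exists u.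
have lt a : A a -> a < l.
  by move=> /nomax[a' Aa' aa']; exact: lt_le_trans (lub _ Aa').
exists l; split=> //; first exact: lle.
split; first by exists b; exact: lt.
move=> c cl; apply: contrapT => nex.
move: cl; rewrite ltNge => /negP; apply; apply: lle => a Aa.
rewrite leNgt; apply/negP => ca; apply: nex; exists a => //.
by rewrite ca lt.
Qed.

(* Between two consecutive limit points of [x] there are only finitely many
   points of [A], so their ranks stay below the next limit point of [x]. *)
Lemma otp_sub_limit A x :
  A `<=` osup x -> (forall a, x a -> exists2 b, x b & a < b) ->
  (forall l, osup x l -> limit_pt A l -> limit_pt x l) ->
  otp A `<=` otp x.
Proof.
move=> Ax xnomax lims.
(* The segment [L] varies so that the induction hypothesis applies to [below l] at a limit point [l]
   of [x], where it yields a [c] below [l]. *)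
have key a : forall L : set K, is_ordinal L -> L `<=` osup x -> L a ->
    (forall b, L b -> exists c, [/\ x c, L c & b < c]) ->
    exists2 c, x c /\ L c & rank A a <= rank x c.
  elim/lt_ind_on: a => a IH L Lord Lx La Lcof.
  have [[m [Am ma mmax]]|nomax] :=
      pselect (exists m, [/\ A m, m < a & forall b, A b -> b < a -> b <= m]).
    have [c [xc Lc] mc] := IH _ ma L Lord Lx (Lord _ _ (ltW ma) La) Lcof.
    have [c' [xc' Lc' cc']] := Lcof _ Lc.
    exists c' => //; apply: rank_le => b Ab ba.
    apply: le_lt_trans (rank_lt xc cc').
    exact: le_trans (rank_mono A (mmax _ Ab ba)) mc.
  have [[b0 [Ab0 b0a]]|emp] := pselect (exists b, A b /\ b < a); last first.
    have [c [xc Lc _]] := Lcof _ La; exists c => //.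
    by apply: rank_le => b Ab ba; exfalso; apply: emp; exists b.
  (* With no last point of [A] below [a], these points have a supremum [l <= a], a limit point of
     [A] and hence of [x]. *)
  have [|b [Ab ba]||l [la llim lgt]] := @lub_limit (A `&` below a) b0 _ _ a.
  - by [].
  - apply: contrapT => nex; apply: nomax; exists b; split=> // b' Ab' b'a.
    by rewrite leNgt; apply/negP => bb'; apply: nex; exists b'.
  - by move=> b [_ /ltW].
  have Ll : L l by apply: Lord La.
  have xl : limit_pt x l.
    apply: lims; first exact: Lx.
    by apply: limit_pt_sub llim => b _ [].
  have [c' [xc' Lc' lc']] := Lcof _ Ll.
  exists c' => //; apply: rank_le => b Ab ba.
  have bl : b < l by apply: lgt.
  have [|e le|//|e|c [xc cl] bc] := IH _ ba (below l).
  - by move=> e e' /= ee' ; exact: le_lt_trans.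
  - by apply: (osup_ordinal (ltW le)); exact: Lx.
  - by move=> /xl.2[c xc /andP[ec cl]]; exists c.
  apply: le_lt_trans bc _; apply: rank_lt => //; exact: lt_trans cl _.
move=> i; rewrite otpE => -[a Aa <-].
have [|//|||c [xc _] ac] := key a (osup x).
- exact: osup_ordinal.
- exact: Ax.
- move=> b [c xc bc]; exists c; split=> //.
  by have [c' xc' cc'] := xnomax _ xc; exists c'.
apply: (otp_ordinal ac); rewrite otpE; by exists c.
Qed.

End WellOrder.

(** * Surjections, unions of at most [nu] sets, and clubs *)

Lemma card_le_surj_on T U (A : set T) (B : set U) (a0 : T) :
  A a0 -> A #<= B ->
  exists h : U -> T, (forall b, A (h b)) /\ forall a, A a -> exists2 b, B b & h b = a.
Proof.
move=> Aa0 /card_leP/unsquash g.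
have /choice[h hP] : forall b : U, exists a, A a /\
    forall a' (Aa' : A a'), val (g (SigSub (mem_set Aa'))) = b -> a = a'.
  move=> b.
  have [[a [Aa eq]]|nex] := pselect (exists a (Aa : A a),
      val (g (SigSub (mem_set Aa))) = b); last first.
    by exists a0; split=> // a' Aa' eq; exfalso; apply: nex; exists a', Aa'.
  exists a; split=> // a' Aa' eq'.
  have : g (SigSub (mem_set Aa)) = g (SigSub (mem_set Aa')).
    by apply: val_inj; rewrite eq eq'.
  by move=> /(@inj _ _ _ g _ _ (mem_set I) (mem_set I))/(congr1 val).
exists h; split=> [b|a Aa]; first exact: (hP b).1.
exists (val (g (SigSub (mem_set Aa)))); last exact: (hP _).2.
exact: set_mem (valP (g _)).
Qed.

Definition words d (K : orderType d) (nu : K) (m : nat) : set (seq K) :=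
  [set s | size s = m /\ all (fun z => z < nu) s].

Definition complete_family d (K : orderType d) (nu : K) (G : set (set K)) : Prop :=
  forall I (P : set I) (F : I -> set K), P #<= below nu ->
    (forall i, P i -> G (F i)) -> G (\bigcup_(i in P) F i).

(** Splitting off the first letter gives an iterated union, which replaces a count of the words. *)
Lemma complete_words d (K : orderType d) (nu : K) (G : set (set K)) m
    (F : seq K -> set K) :
  complete_family nu G -> (forall s, words nu m s -> G (F s)) ->
  G (\bigcup_(s in words nu m) F s).
Proof.
move=> Gc; elim: m F => [|m IH] F GF.
  rewrite (_ : \bigcup_(s in _) F s = F [::]); first exact: GF.
  apply/seteqP; split=> [a [s [/size0nil-> _]] //|a Fa]; by exists [::].
rewrite (_ : \bigcup_(s in _) F s =
    \bigcup_(z in below nu) \bigcup_(s in words nu m) F (z :: s)).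
  apply: Gc; first exact: card_lexx.
  move=> z zn; apply: IH => s [sm sn]; apply: GF; split=> /=; first by rewrite sm.
  by rewrite zn.
apply/seteqP; split=> a.
  move=> [s [+ +] +]; case: s => // z s [sm] /= /andP[zn sn] Fa.
  by exists z => //; exists s.
move=> [z zn [s [sm sn] Fa]]; exists (z :: s) => //; split=> /=; first by rewrite sm.
by apply/andP.
Qed.

Lemma club_inE d (K : orderType d) (D : set K) :
  club_in [set: K] D <->
  (forall a, limit_pt D a -> D a) /\ forall b, exists2 c, D c & b < c.
Proof.
split=> [[/closed_inE[_ cl] unb]|[cl unb]]; split.
- by move=> a; exact: cl.
- by move=> b; have : osup D b by rewrite unb.
- by apply/closed_inE; split=> // a _; exact: cl.
- by apply/seteqP; split=> // b _; have [c Dc bc] := unb b; exists c.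
Qed.

Lemma closed_inI d (K : orderType d) (X D D' : set K) :
  closed_in X D -> closed_in X D' -> closed_in X (D `&` D').
Proof.
move=> /closed_inE[DX Dcl] /closed_inE[_ Dcl']; apply/closed_inE.
split=> [a [/DX]//|a Xa lim]; split; [apply: Dcl|apply: Dcl'] => //;
  by apply: limit_pt_sub lim => b _ [].
Qed.

(** * Cofinality *)

Section Cofinality.
Context {d : Order.disp_t} {K : orderType d} (wo : least_elements K).
Implicit Types (a b c i j : K) (A B X L : set K).

Lemma cof_sub nu X (f : K -> K) :
  (forall z, z < nu -> X (f z)) ->
  (forall b, X b -> exists2 z, z < nu & b <= f z) -> cof X `<=` below nu.
Proof.
(* The increasing enumeration of the records of [f] witnesses the bound. *)
move=> fX fcof i cofi.
pose rec z := z < nu /\ forall y, y < z -> f y < f z.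
have recB z : rec z -> rank wo [set f z | z in rec] (f z) <= z.
  elim/(lt_ind_on wo): z => z IH rz; apply: rank_le => _ [y ry <-] fyz.
  have yz : y < z.
    rewrite ltNge le_eqVlt; apply/negP => /orP[/eqP eq|/ry.2].
      by move: fyz; rewrite eq ltxx.
    by move=> /(lt_trans fyz); rewrite ltxx.
  exact: le_lt_trans (IH _ yz ry) yz.
have := cofi [set f z | z in rec]; rewrite (otpE wo).
case=> [|_ [z rz <-] <-]; last by apply: le_lt_trans (recB _ rz) rz.1.
split=> [_ [z [zn _] <-]|b Xb]; first exact: fX.
have [z0 z0n bz0] := fcof _ Xb.
(* The least index whose value reaches [b] is a record, since all earlier values are below [b]. *)
have [|z [zn bz] zle] := wo (P := [set z | z < nu /\ b <= f z]); first by exists z0.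
exists (f z) => //; exists z => //; split=> // y yz.
apply: lt_le_trans bz; rewrite ltNge; apply/negP => bfy.
by have := zle y (conj (lt_trans yz zn) bfy); rewrite leNgt yz.
Qed.

(** If [m] is the least element outside [cof X], the order type of some cofinal set omits [m] and is
    therefore contained in [cof X]. *)
Lemma cof_attained X : exists2 A, cofinal_in X A & otp A = cof X.
Proof.
have XX : cofinal_in X X by split=> // b Xb; exists b.
have [all|] := pselect (forall i, cof X i).
  by exists X => //; apply/seteqP; split=> i // _; exact: all.
move=> /existsNP/wo[m nm mle].
have [A AX nA] : exists2 A, cofinal_in X A & ~ otp A m.
  by apply: contrapT => nex; apply: nm => A AX; apply: contrapT => nA;
    apply: nex; exists A.
exists A => //; apply/seteqP; split=> i; last by apply.
move=> Ai; apply: contrapT => /mle mi; apply: nA; exact: (otp_ordinal wo mi Ai).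
Qed.

(** A map from [nu] onto [cof X], followed by the enumeration of a cofinal set of that order type,
    is a map to which [cof_sub] applies. *)
Lemma cof_card nu X : cof X #<= below nu -> cof X `<=` below nu.
Proof.
move=> le i0 ci0; have [h [hto hsurj]] := card_le_surj_on ci0 le.
have [A [AX Acof] Aotp] := cof_attained X.
have /choice[f fP] : forall z, exists a, A a /\ rank wo A a = h z.
  move=> z; have := hto z; rewrite -Aotp (otpE wo) => -[a Aa ra].
  by exists a.
move: i0 ci0; apply: (@cof_sub nu X f) => [z _|b Xb]; first exact: AX (fP z).1.
have [a Aa ba] := Acof _ Xb.
have [|z zn hz] := hsurj (rank wo A a).
  by rewrite -Aotp (otpE wo); exists a.
exists z => //; rewrite (_ : f z = a) //.
have [Af rf] := fP z; apply: (rank_inj (wo := wo) Af Aa); by rewrite rf.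
Qed.

Lemma additive_complete nu X (J : set (set K)) :
  ~ (cof X `<=` below nu) -> additive (cof X) J -> complete_family nu J.
Proof.
move=> ncof Jadd I P F Pnu PJ.
rewrite -(bigcup_image P F (fun A => A)); apply: Jadd => [_ [i Pi <-]|le].
  exact: PJ.
apply: ncof; apply: cof_card; apply: card_le_trans le _.
exact: card_le_trans (card_image_le F P) Pnu.
Qed.

(** The map enumerates a cofinal set of least order type. It is unconstrained beyond that type, so
    [f z < g] is claimed only for the [z] found. *)
Lemma E_le_cofinal_map nu g :
  E_le nu g -> exists f : K -> K,
    forall b, b < g -> exists2 z, z < nu & b <= f z /\ f z < g.
Proof.
rewrite /E_le /= => cg; have [A [Ag Acof] Aotp] := cof_attained (below g).
have /choice[f fP] : forall z, exists a, (exists2 a, A a & rank wo A a = z) ->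
    A a /\ rank wo A a = z.
  move=> z; have [[a Aa ra]|nex] := pselect (exists2 a, A a & rank wo A a = z).
    by exists a.
  by exists g.
exists f => b /Acof[a Aa ba]; exists (rank wo A a).
  by apply: cg; rewrite -Aotp (otpE wo); exists a.
have [|Af rf] := fP (rank wo A a); first by exists a.
by rewrite (rank_inj Af Aa rf); split=> //; exact: Ag.
Qed.

End Cofinality.

(** * Clubs and the nonstationary ideal *)

Section Clubs.
Context {d : Order.disp_t} {K : orderType d} (wo : least_elements K).
Context (cofK : cof [set: K] = [set: K]) (nu : K) (nu_inf : omega `<=` below nu).

Lemma nat_le_nu : [set: nat] #<= below nu.
Proof.
apply/infiniteP => fin; have : below nu nu by apply: nu_inf.
by rewrite /below /= ltxx.
Qed.

(** Otherwise the values would be cofinal in kappa, and regularity would put [nu] below itself. *)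
Lemma index_bound I (P : set I) (f : I -> K) :
  P #<= below nu -> exists b, forall i, P i -> f i < b.
Proof.
move=> Pnu; apply: contrapT => nb.
have [[i0 Pi0]|emp] := pselect (P !=set0); last first.
  by apply: nb; exists nu => i Pi; exfalso; apply: emp; exists i.
have [h [hP hsurj]] := card_le_surj_on Pi0 Pnu.
suff nu_cof b : exists2 z, z < nu & b <= f (h z).
  have : cof [set: K] nu by rewrite cofK.
  by move=> /(cof_sub wo (X := setT) (f := f \o h) (fun _ _ => Logic.I)
    (fun b _ => nu_cof b)); rewrite /below /= ltxx.
apply: contrapT => nex; apply: nb; exists b => i Pi.
rewrite ltNge; apply/negP => bi; apply: nex.
by have [z zn hz] := hsurj _ Pi; exists z => //; rewrite hz.
Qed.

(** Starting from any [b], iterate countably often a step that passes a point of every [D i]; the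
    supremum is a common limit point. *)
Lemma club_limits I (P : set I) (D : I -> set K) :
  P #<= below nu -> (forall i, P i -> club_in [set: K] (D i)) ->
  exists2 E, club_in [set: K] E & forall a, E a -> forall i, P i -> limit_pt (D i) a.
Proof.
move=> Pnu Dclub.
exists [set a | below a !=set0 /\ forall i, P i -> limit_pt (D i) a]; last first.
  by move=> a [_].
apply/club_inE; split=> [a [ne lim]|b].
  split=> // i Pi; split=> // b /lim[c [_ cl] /andP[bc ca]].
  have [_ /(_ _ bc)[e De /andP[be ec]]] := cl _ Pi.
  by exists e => //; rewrite be /=; exact: lt_trans ca.
have /choice[g gP] : forall c, exists c', c < c' /\
    forall i, P i -> exists2 e, D i e & c < e < c'.
  move=> c.
  have /choice[f fP] : forall i, exists e, P i -> D i e /\ c < e.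
    move=> i; have [Pi|nPi] := pselect (P i); last by exists c.
    by have /club_inE[_ /(_ c)[e De ce]] := Dclub _ Pi; exists e.
  have [u uP] := index_bound f Pnu.
  (* The bound [v] makes the step strictly increasing even when [P] is empty. *)
  have [v vP] := index_bound (fun _ : nat => c) nat_le_nu.
  exists (Order.max u v); split; first by rewrite lt_max (vP 0%N) // orbT.
  move=> i Pi; have [Df cf] := fP _ Pi; exists (f i) => //.
  by rewrite cf lt_max uP.
have [u uP] := index_bound (fun n => iter n g b) nat_le_nu.
have [|_ [n _ <-]|_ [n _ <-]|l [_ llim lgt]] :=
    @lub_limit _ _ wo (range (fun n => iter n g b)) b _ _ u.
- by exists 0%N.
- by exists (iter n.+1 g b); [exists n.+1|exact: (gP _).1].
- exact/ltW/uP.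
exists l; last by apply: lgt; exists 0%N.
split=> [|i Pi]; first by case: llim.
split=> [|c cl]; first by case: llim.
have [_ [n _ <-] /andP[cn _]] := llim.2 _ cl.
have [e De /andP[ne en]] := (gP (iter n g b)).2 _ Pi.
exists e => //; rewrite (lt_trans cn ne) /=; apply: lt_trans en _.
by apply: lgt; exists n.+1.
Qed.

Definition nonstationary (A : set K) : Prop :=
  exists2 E, club_in [set: K] E & forall a, E a -> ~ A a.

Lemma nonstationary_complete : complete_family nu nonstationary.
Proof.
move=> I P F Pnu FP.
have /choice[D DP] : forall i, exists D, P i ->
    club_in [set: K] D /\ forall a, D a -> ~ F i a.
  move=> i; have [/FP[E Ecl EF]|nPi] := pselect (P i); first by exists E.
  by exists setT.
have [i Pi|E Ecl Elim] := club_limits Pnu (D := D); first by have [] := DP _ Pi.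
exists E => // a Ea [i Pi Fa]; have [Dcl] := DP _ Pi; move/(_ a); apply => //.
by have /club_inE[cl _] := Dcl; apply: cl; exact: Elim.
Qed.

Lemma club_inI D D' :
  club_in [set: K] D -> club_in [set: K] D' -> club_in [set: K] (D `&` D').
Proof.
move=> Dcl Dcl'.
have [[] _ //|E /club_inE[_ Eunb] Elim] := @club_limits bool setT
  (fun b => if b then D else D') (card_le_trans (countableP _) nat_le_nu).
have [/club_inE[Dc _] /club_inE[Dc' _]] := (Dcl, Dcl').
split; first by apply: closed_inI; [case: Dcl|case: Dcl'].
apply/seteqP; split=> // b _; have [c Ec bc] := Eunb b; exists c => //.
by split; [apply: Dc|apply: Dc']; [exact: (Elim _ Ec true)|exact: (Elim _ Ec false)].
Qed.

End Clubs.

(** * The class [KK] and the functions [post] *)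

Lemma limit_pt_notin_seq d (K : orderType d) (A : set K) (a b : K) (t : seq K) :
  limit_pt A a -> b < a -> exists2 h, A h & b < h < a /\ h \notin t.
Proof.
move=> [_ lim]; elim: t b => [|u t IH] b ba.
  by have [h Ah bha] := lim _ ba; exists h.
have [ua|au] := ltP u a; last first.
  have [h Ah [/andP[bh ha] ht]] := IH _ ba; exists h; rewrite // bh ha.
  by split=> //; rewrite inE negb_or ht andbT lt_eqF //; exact: lt_le_trans au.
have [|h Ah] := IH (Order.max b u); first by rewrite gt_max ba.
rewrite gt_max => -[/andP[/andP[bh uh] ha] ht]; exists h; rewrite // bh ha.
by split=> //; rewrite inE negb_or ht andbT gt_eqF.
Qed.

Lemma accpE d (K : orderType d) (A : set K) (a : K) :
  accp A a <-> ssup A a /\ limit_pt A a.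
Proof.
split=> [[sA eq ne]|[sA /limit_ptE[eq ne]]]; last by split.
by split=> //; apply/limit_ptE.
Qed.

Lemma osup_below_limit d (K : orderType d) (A : set K) (a : K) :
  limit_pt A a -> osup (A `&` below a) = below a.
Proof. by move=> /limit_ptE[]. Qed.

(** The supremum of [x] belongs to [x] exactly when [x] has a maximum. *)
Lemma KK_E d (K : orderType d) (x : set K) :
  KK x <-> [/\ x !=set0, (forall a, x a -> exists2 b, x b & a < b)
            & forall a, osup x a -> limit_pt x a -> x a].
Proof.
split=> [[ne acl nmem]|[ne nomax cl]]; split=> //.
- move=> a xa; apply: contrapT => nex; apply: nmem; exists a => //.
  apply/seteqP; split=> [c [b xb cb]|c ca]; last by exists a.
  apply: lt_le_trans cb _; rewrite leNgt; apply/negP => ab.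
  by apply: nex; exists b.
- move=> a [b xb ab] lim; apply: acl; apply/accpE; split=> //.
  by exists b => //; exact: ltW.
- move=> a /accpE[[b xb ab] lim]; apply: cl => //.
  by have [c xc bc] := nomax _ xb; exists c => //; exact: le_lt_trans bc.
- move=> [a xa eq]; have [b xb ab] := nomax _ xa.
  have : osup x a by exists b.
  by rewrite eq /below /= ltxx.
Qed.

Lemma KK_sub_osup d (K : orderType d) (x : set K) : KK x -> x `<=` osup x.
Proof. by move=> /KK_E[_ nomax _] a /nomax[b xb ab]; exists b. Qed.

Lemma KK_below d (K : orderType d) (x : set K) (a : K) :
  KK x -> x a -> limit_pt x a -> KK (x `&` below a).
Proof.
move=> /KK_E[_ nomax cl] xa lim; apply/KK_E; split.
- have [[b ba] /(_ b)] := lim; move=> /(_ ba)[c xc /andP[_ ca]].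
  by exists c.
- move=> b [xb ba]; have [c xc /andP[bc ca]] := lim.2 _ ba.
  by exists c.
- rewrite osup_below_limit // => b ba lim'; split=> //; apply: cl.
    by exists a.
  by apply: limit_pt_sub lim' => ? _ [].
Qed.

(** The last condition confines the points inserted for [g] to the gap just below [g]; at a limit
    point of [x] it admits none. *)
Definition expand d (K : orderType d) (e : K -> K -> K) (s : seq K) (x : set K) :
    set K :=
  x `|` [set h | exists g z, [/\ x g, z \in s, h = e g z, h < g
                              & forall c, x c -> c < g -> c < h]].

(* The second disjunct is a tail of [X], nonempty only when [D `&` X] is
   bounded in [X]; it makes the trace unbounded in any [X] without a maximum. *)
Definition trace d (K : orderType d) (D X : set K) : set K :=
  [set c | X c /\ (D c \/ forall a, D a -> X a -> a <= c)].

Definition drop_to d (K : orderType d) (E A : set K) : set K :=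
  [set q | E q /\ exists2 h, A h & q <= h /\ forall a, E a -> a <= h -> a <= q].

(** The trace depends on [x] only through its supremum, which is what makes the images of sets with
    a common tail share a tail. *)
Definition post d (K : orderType d) (e : K -> K -> K) (s : seq K) (D x : set K) :
    set K :=
  drop_to (trace D (osup x)) (expand e s x).

(** * Traces of a club *)

Section Trace.
Context {d : Order.disp_t} {K : orderType d}.
Implicit Types (D X : set K).

(** If a point of [D] in [X] lies above [a], all trace points below [a] belong to [D]; otherwise [a]
    satisfies the tail condition. *)
Lemma trace_closed D X :
  is_ordinal X -> (forall a, limit_pt D a -> D a) ->
  forall a, X a -> limit_pt (trace D X) a -> trace D X a.
Proof.
move=> Xord Dcl a Xa lim; split=> //.
have [|nD] := pselect (limit_pt D a); first by left; exact: Dcl.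
right=> b Db Xb; apply: contrapT => /negP; rewrite -ltNge => ab.
apply: nD; apply: limit_pt_sub lim => c ca [Xc [//|]] /(_ b Db Xb).
by rewrite leNgt (lt_trans ca ab).
Qed.

Lemma trace_unbounded D X b :
  (forall b, X b -> exists2 c, X c & b < c) -> X b ->
  exists2 c, trace D X c & b < c.
Proof.
move=> nomax Xb.
have [[c [Dc Xc bc]]|nex] := pselect (exists c, [/\ D c, X c & b < c]).
  by exists c => //; split=> //; left.
have [c Xc bc] := nomax _ Xb; exists c => //; split=> //; right=> a Da Xa.
rewrite leNgt; apply/negP => ca; apply: nex; exists a; split=> //.
exact: lt_trans ca.
Qed.

(** If [c] is in the tail for [below a], a later trace point [c'] below [a] is not in [D], so it is
    in the tail for [X]. Thus [D] has no point of [X] beyond [c'], and then none beyond [c]. *)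
Lemma trace_below D X a :
  is_ordinal X -> X a -> limit_pt (trace D X) a ->
  trace D (below a) = trace D X `&` below a.
Proof.
move=> Xord Xa lim; have subX c : c < a -> X c by move=> /ltW/Xord; apply.
apply/seteqP; split=> c.
  move=> [ca]; case=> [Dc|cub]; split=> //; split; first exact: subX.
  - by left.
  - exact: subX.
  right=> b Db Xb; have [c' [_ trc'] /andP[cc' c'a]] := lim.2 _ ca.
  case: trc' => [Dc'|/(_ _ Db Xb) bc'].
    by have := cub _ Dc' c'a; rewrite leNgt cc'.
  by apply: cub => //; exact: le_lt_trans c'a.
move=> [[_ cD] ca]; split=> //; case: cD => [Dc|cub]; first by left.
by right=> b Db ba; apply: cub => //; exact: subX.
Qed.

End Trace.

(** * The postprocessing properties of [post] *)

Section DropTo.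
Context {d : Order.disp_t} {K : orderType d} (wo : least_elements K).
Implicit Types (D X E A x y : set K).

(** For values [q' < r] below [a], a point [h] that drops to [q'] satisfies [q' <= h < r], as
    otherwise it would drop to [r] or beyond. *)
Lemma drop_to_limit E A a : limit_pt (drop_to E A) a -> limit_pt A a.
Proof.
move=> [ne lim]; split=> // b /lim[q [Eq _] /andP[bq qa]].
have [q' [Eq' [h Ah [q'h hmax]]] /andP[qq' q'a]] := lim _ qa.
have [r [Er [h' Ah' [rh' hmax']]] /andP[q'r ra]] := lim _ q'a.
exists h => //; apply/andP; split.
  by apply: lt_le_trans q'h; exact: lt_trans qq'.
apply: le_lt_trans ra; rewrite leNgt; apply/negP => /ltW rh.
by have := hmax _ Er rh; rewrite leNgt q'r.
Qed.

(** Without a maximum, the points of [E] up to [h] would have a supremum that is a limit point of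
    [E], hence itself one of them. *)
Lemma drop_to_exists E X h d0 :
  is_ordinal X -> (forall a, X a -> limit_pt E a -> E a) -> X h ->
  E d0 -> d0 <= h ->
  exists q, [/\ E q, d0 <= q, q <= h & forall a, E a -> a <= h -> a <= q].
Proof.
move=> Xord Ecl Xh Ed0 d0h.
have [[q [Eq qh qmax]]|nomax] :=
    pselect (exists q, [/\ E q, q <= h & forall a, E a -> a <= h -> a <= q]).
  by exists q; split=> //; exact: qmax.
have [|a [Ea ah]|a []//|l [lh llim lgt]] :=
    @lub_limit _ _ wo [set a | E a /\ a <= h] d0 _ _ h.
- by [].
- apply: contrapT => nex; apply: nomax; exists a; split=> // b Eb bh.
  by rewrite leNgt; apply/negP => ab; apply: nex; exists b.
have El : E l.
  apply: Ecl; first exact: Xord lh Xh.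
  by apply: limit_pt_sub llim => ? _ [].
by have := lgt _ (conj El lh); rewrite ltxx.
Qed.

(** If [x] has no point between [b] and [a], all points inserted there belong to one gap of [x], so
    they are finitely many. *)
Lemma expand_limit e s x a : limit_pt (expand e s x) a -> limit_pt x a.
Proof.
move=> lim; split=> [|b ba]; first by case: lim.
apply: contrapT => nex.
have inserted h : expand e s x h -> b < h < a ->
    exists g, [/\ x g, a <= g, h \in [seq e g z | z <- s]
               & forall c, x c -> c < g -> c < h].
  move=> [xh /andP[bh ha]|[g [z [xg zs -> hg gap]]] /andP[bh ha]].
    by exfalso; apply: nex; exists h; rewrite ?bh.
  exists g; split=> //; last by apply/mapP; exists z.
  rewrite leNgt; apply/negP => ga; apply: nex; exists g; rewrite // ga andbT.
  exact: lt_trans hg.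
have [h1 Ah1 h1ba] := lim.2 _ ba.
have [g1 [xg1 ag1 _ gap1]] := inserted _ Ah1 h1ba.
have [h Ah [hba hnot]] := limit_pt_notin_seq [seq e g1 z | z <- s] lim ba.
have [g [xg ag hs gap]] := inserted _ Ah hba.
(* If the two differed, the smaller would lie below a point inserted for the larger, hence below
   [a]. *)
have gg1 : g = g1.
  have [/andP[_ ha] /andP[_ h1a]] := (hba, h1ba).
  case: (ltgtP g g1) => //.
    by move=> /gap1-/(_ xg); rewrite ltNge (le_trans (ltW h1a) ag).
  by move=> /gap-/(_ xg1); rewrite ltNge (le_trans (ltW ha) ag1).
by move: hnot; rewrite -gg1 hs.
Qed.

Section Post.
Context (e : K -> K -> K) (s : seq K) (D : set K).
Context (Dcl : forall a, limit_pt D a -> D a).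

Lemma osup_nomax x b : KK x -> osup x b -> exists2 c, osup x c & b < c.
Proof. by move=> Kx [c xc bc]; exists c => //; exact: KK_sub_osup. Qed.

Lemma post_limit x a : limit_pt (post e s D x) a -> limit_pt x a.
Proof. by move=> /drop_to_limit/expand_limit. Qed.

Lemma post_sub_osup x : post e s D x `<=` osup x.
Proof. by move=> q [[]]. Qed.

Lemma post_cofinal x b : KK x -> osup x b -> exists2 q, post e s D x q & b < q.
Proof.
move=> Kx xb.
have [c trc bc] := trace_unbounded D (fun b => osup_nomax Kx) xb.
have [h xh ch] := trc.1.
have [|||||q [Eq cq qh qmax]] := @drop_to_exists (trace D (osup x)) (osup x) h c.
- exact: osup_ordinal.
- by apply: trace_closed => //; exact: osup_ordinal.
- exact: KK_sub_osup.
- by [].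
- exact: ltW.
exists q; last exact: lt_le_trans cq.
by split=> //; exists h => //; left.
Qed.

(** The limit point [a] belongs both to [x] and to the trace, so it drops to itself. *)
Lemma post_closed x a :
  KK x -> osup x a -> limit_pt (post e s D x) a -> post e s D x a.
Proof.
move=> Kx Xa lim; have /KK_E[_ _ cl] := Kx.
have xa : x a by apply: cl => //; exact: post_limit lim.
split; last by exists a; [left|].
apply: trace_closed => //; first exact: osup_ordinal.
by apply: limit_pt_sub lim => ? _ [].
Qed.

Lemma post_osup x : KK x -> osup (post e s D x) = osup x.
Proof.
move=> Kx; apply/seteqP; split=> b; last exact: post_cofinal.
move=> [q /post_sub_osup Xq bq]; exact: osup_ordinal (ltW bq) Xq.
Qed.

Lemma post_club x : KK x -> club_in (osup x) (post e s D x).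
Proof.
move=> Kx; split; last exact: post_osup.
apply/closed_inE; split; first exact: post_sub_osup.
by move=> a; exact: post_closed.
Qed.

Lemma post_KK x : KK x -> KK (post e s D x).
Proof.
move=> Kx; apply/KK_E; split.
- have /KK_E[[a /(KK_sub_osup Kx)Xa] _ _] := Kx.
  by have [q] := post_cofinal Kx Xa; exists q.
- by move=> a /post_sub_osup /(post_cofinal Kx).
- by rewrite post_osup // => a; exact: post_closed.
Qed.

Lemma post_acc x a : KK x -> acc (post e s D x) a -> x a /\ limit_pt x a.
Proof.
move=> Kx [/post_sub_osup Xa /accpE[_ /post_limit lim]]; split=> //.
by have /KK_E[_ _] := Kx; apply.
Qed.

Lemma expand_below x a :
  limit_pt x a -> expand e s (x `&` below a) = expand e s x `&` below a.
Proof.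
move=> lim; apply/seteqP; split=> h.
  move=> [[xh ha]|[g [z [[xg ga] zs -> hg gap]]]]; split=> //.
  - by left.
  - right; exists g, z; split=> // c xc cg.
    by apply: gap => //; split=> //; exact: lt_trans ga.
  - exact: lt_trans ga.
move=> [[xh|[g [z [xg zs -> hg gap]]]] ha]; first by left.
right; exists g, z; split=> //.
(* A point of [x] between [h] and the limit [a] keeps [h] out of any gap that ends at or above
   [a]. *)
- split=> //=; rewrite /below /= ltNge; apply/negP => ag.
  have [c xc /andP[hc ca]] := lim.2 _ ha.
  by have := gap _ xc (lt_le_trans ca ag); rewrite ltNge (ltW hc).
- by move=> c [xc _]; exact: gap.
Qed.

(** Since [a] is in the trace, no point at or above [a] drops below it; the trace and the expansion
    both localize at [a]. *)
Lemma post_below x a :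
  KK x -> acc (post e s D x) a ->
  post e s D x `&` below a = post e s D (x `&` below a).
Proof.
move=> Kx acca; have [xa lim] := post_acc Kx acca.
have [[[Xa Da] _] /accpE[_ plim]] := acca.
have Elim : limit_pt (trace D (osup x)) a.
  by apply: limit_pt_sub plim => ? _ [].
have Ea : trace D (osup x) a by split.
rewrite /post osup_below_limit // expand_below //.
rewrite (trace_below (@osup_ordinal _ _ x) Xa Elim).
apply/seteqP; split=> q.
  move=> [[Eq [h Ah [qh hmax]]] qa]; split=> //; exists h.
    split=> //; rewrite /below /= ltNge; apply/negP => /(hmax _ Ea).
    by rewrite leNgt qa.
  by split=> // b [Eb _]; exact: hmax.
move=> [[Eq qa] [h [Ah ha] [qh hmax]]]; split=> //; split=> //; exists h => //.
split=> // b Eb bh; apply: hmax => //; split=> //; exact: le_lt_trans ha.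
Qed.

(** Points up to [b] are below [h] anyway, so membership of [h] is decided by the points above
    [b]. *)
Lemma expand_agree x y b c h :
  (forall a, b < a -> (x a <-> y a)) -> x c -> b < c -> c < h ->
  expand e s x h -> expand e s y h.
Proof.
move=> xy xc bc ch [xh|[g [z [xg zs eh hg gap]]]].
  by left; apply/xy => //; exact: lt_trans ch.
right; exists g, z; split=> //.
  apply/xy => //; apply: lt_trans bc _; exact: lt_trans hg.
move=> a ya ag; have [ba|ab] := ltP b a; last exact: le_lt_trans (lt_trans bc ch).
by apply: gap => //; apply/xy.
Qed.

Lemma post_agree x y b c q :
  osup x = osup y -> (forall a, b < a -> (x a <-> y a)) -> x c -> b < c -> c < q ->
  post e s D x q -> post e s D y q.
Proof.
rewrite /post => -> xy xc bc cq [Eq [h Ah [qh hmax]]]; split=> //; exists h => //.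
exact: expand_agree xy xc bc (lt_le_trans cq qh) Ah.
Qed.

Lemma post_otp x : KK x -> otp (post e s D x) `<=` otp x.
Proof.
move=> Kx; have /KK_E[_ nomax _] := Kx.
apply: (otp_sub_limit wo) => //; first exact: post_sub_osup.
by move=> l _; exact: post_limit.
Qed.

Lemma sqsub_starE x y :
  y `<=` osup y ->
  sqsub_star y x <->
  exists2 b, osup y b & forall a, b < a -> ((x `&` osup y) a <-> y a).
Proof.
move=> yy; rewrite /sqsub_star.
split=> [[_ /existsNP[b /not_implyP[yb nb]]]|[b yb agree]].
  exists b => // a ba; split=> [za|ya]; apply: contrapT => na; apply: nb.
    by exists a => //; right.
  by exists a => //; left.
split=> [c [a sd ca]|].
  have ya : osup y a by case: sd => -[]; [move=> /yy|move=> [_]].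
  exact: osup_ordinal (ltW ca) ya.
move=> /(_ b yb)[a sd /agree[zy yz]].
by case: sd => -[h nh]; apply: nh; [exact: yz|exact: zy].
Qed.

Lemma post_postprocessing : postprocessing_star (post e s D).
Proof.
split=> [x|x Kx]; first exact: post_KK.
split.
- exact: post_club.
- move=> a acca; have [xa lim] := post_acc Kx acca; split=> //.
  by apply/accpE; split=> //; exists a.
- by move=> a; exact: post_below.
move=> y Ky /sqsub_starE-/(_ (KK_sub_osup Ky))[b yb agree] [a acca ya].
have [xa lim] := post_acc Kx acca.
apply/sqsub_starE; first exact: KK_sub_osup (post_KK Ky).
(* This leaves a comparison of [y] with the part of [x] below [a], which has the same supremum and
   agrees with [y] above [b]. *)
rewrite post_osup // ya post_below //.
rewrite ya in agree yb; have [c xc /andP[bc ca]] := lim.2 _ yb.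
exists c => // q cq.
have Kxa := KK_below Kx xa lim.
have eqo : osup (x `&` below a) = osup y by rewrite osup_below_limit.
split; apply: (@post_agree _ _ b c q) => //.
- by move=> q' bq'; apply: iff_sym; exact: agree.
- by apply/agree.
Qed.

End Post.

End DropTo.

(** * Floors in decreasing clubs and the guessing argument *)

Section Guessing.
Context {d : Order.disp_t} {K : orderType d} (wo : least_elements K).
Implicit Types (D E A x : set K).

Definition floor D (h q : K) : Prop :=
  [/\ D q, q <= h & forall a, D a -> a <= h -> a <= q].

Lemma floor_exists D h d0 :
  (forall a, limit_pt D a -> D a) -> D d0 -> d0 <= h ->
  exists2 q, floor D h q & d0 <= q.
Proof.
move=> Dcl Dd0 d0h.
have [|q [Dq d0q qh qmax]] :=
    @drop_to_exists _ _ wo D setT h d0 (fun _ _ _ => id) _ Logic.I Dd0 d0h.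
  by move=> a _; exact: Dcl.
by exists q.
Qed.

(** Floors decrease with [i], so they are constant once the least one is reached. If some [D i] has
    no point up to [h], there are no floors from [i] on. *)
Lemma floor_stable (D : nat -> set K) h :
  (forall i j, (i <= j)%N -> D j `<=` D i) ->
  (forall i a, limit_pt (D i) a -> D i a) ->
  exists i0, forall i, (i0 <= i)%N -> forall q, floor (D i) h q -> D i.+1 q.
Proof.
move=> Ddec Dcl.
have [[i1 emp]|ne] := pselect (exists i, forall a, D i a -> h < a).
  exists i1 => i ii q [Dq qh _].
  by have := emp _ (Ddec _ _ ii _ Dq); rewrite ltNge qh.
have fl i : exists q, floor (D i) h q.
  have [a [Da ah]] : exists a, D i a /\ a <= h.
    apply: contrapT => nex; apply: ne; exists i => a Da.
    by rewrite ltNge; apply/negP => ah; apply: nex; exists a.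
  by have [q] := floor_exists (Dcl i) Da ah; exists q.
have [|q0 [i0 [Dq0 q0h q0max]] q0min] :=
    wo (P := [set q | exists i, floor (D i) h q]).
  by have [q] := fl 0%N; exists q, 0%N.
exists i0 => i ii q [Dq qh qmax]; have [q' [Dq' q'h q'max]] := fl i.+1.
suff -> : q = q' by [].
apply/eqP; rewrite eq_le (qmax q') //; last exact: Ddec Dq'.
rewrite andbT; apply: le_trans (q0max _ (Ddec _ _ ii _ Dq) qh) _.
by apply: q0min; exists i.+1.
Qed.

Lemma floor_stable_seq (D : nat -> set K) (t : seq K) :
  (forall i j, (i <= j)%N -> D j `<=` D i) ->
  (forall i a, limit_pt (D i) a -> D i a) ->
  exists i0, forall i, (i0 <= i)%N ->
    forall h, h \in t -> forall q, floor (D i) h q -> D i.+1 q.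
Proof.
move=> Ddec Dcl; elim: t => [|h t [i0 IH]]; first by exists 0%N.
have [i1 H] := floor_stable h Ddec Dcl.
exists (maxn i0 i1) => i; rewrite geq_max => /andP[ii0 ii1] h'.
by rewrite inE => /orP[/eqP->|h't]; [exact: H|exact: IH].
Qed.

(** Points [c] of [E] and values [f z] are chosen alternately; the floor of [f z] lies between [c]
    and [f z], so the floors are distinct. The list [s] is fixed before [D], because the clubs used
    later depend on [s]. *)
Lemma interleave nu g (f : K -> K) E m b :
  limit_pt E g ->
  (forall b, b < g -> exists2 z, z < nu & b <= f z /\ f z < g) -> b < g ->
  exists s, [/\ words nu m s, forall z, z \in s -> b < f z < g &
    forall D, E `<=` D -> (forall a, limit_pt D a -> D a) ->
      exists p, [/\ size p = m, path <%O b p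
        & forall q, q \in p -> exists2 z, z \in s & floor D (f z) q]].
Proof.
move=> lim fcof; elim: m b => [|m IH] b bg.
  by exists [::]; split=> // D _ _; exists [::].
have [c Ec /andP[bc cg]] := lim.2 _ bg.
have [z zn [cfz fzg]] := fcof _ cg.
have [s [[sm sn] sg sD]] := IH _ fzg.
have bfz := lt_le_trans bc cfz.
exists (z :: s); split.
- by split=> /=; rewrite ?sm // zn.
- move=> z'; rewrite inE => /orP[/eqP->|/sg/andP[fz z'g]]; first by rewrite bfz.
  by rewrite z'g (lt_trans bfz).
move=> D ED Dcl; have [p [pm pp pq]] := sD _ ED Dcl.
have [q fq cq] := floor_exists Dcl (ED _ Ec) cfz.
exists (q :: p); split=> /=.
- by rewrite pm.
- rewrite (lt_le_trans bc cq) /=; have [_ qfz _] := fq.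
  case: p pp {pm pq} => //= q' p /andP[fzq' ->].
  by rewrite (le_lt_trans qfz fzq').
move=> q'; rewrite inE => /orP[/eqP->|/pq[z' z's fz']].
  by exists z => //; rewrite inE eqxx.
by exists z' => //; rewrite inE z's orbT.
Qed.

Lemma omega_bound (sigma : K) : omega sigma ->
  exists m, forall t : seq K,
    uniq t -> (forall a, a \in t -> a < sigma) -> (size t < m)%N.
Proof.
move=> /finite_seqP[l lE]; exists (size l).+1 => t tu ts.
rewrite ltnS; apply: uniq_leq_size => // a /ts ha.
have : below sigma a by [].
by rewrite lE.
Qed.

Lemma suc_rank (sigma : K) A c :
  suc (below sigma) A c -> A c /\ rank wo A c <= sigma.
Proof.
move=> [j [j' [js [_ jj'] _ /(nth_eltE wo)[Ac rc]]]]; split=> //.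
by rewrite rc; exact: jj'.
Qed.

(** Here [a] and [g] are the elements of index 0 and 1. *)
Lemma suc_one A a g :
  A a -> (forall c, A c -> a <= c) -> A g -> a < g ->
  (forall c, A c -> c < g -> c = a) -> suc ord_one A g.
Proof.
move=> Aa amin Ag ag gmin; exists (rank wo A a), (rank wo A g); split.
- by move=> b; apply: rank_le => c /amin; rewrite leNgt => /negP.
- split; first exact: rank_lt.
  by move=> c ac; apply: rank_le => b Ab /(gmin _ Ab) ->.
- by rewrite (otpE wo); exists g.
- exact/(nth_eltE wo).
Qed.

(* The points of [post e s (D i) x] between [b] and [g] are the floors in [D i]
   of finitely many points, which do not depend on [i]; hence they belong to
   [D i.+1] for large [i], and [s] is chosen to have many of them. *)
Lemma post_guess nu sigma m (e : K -> K -> K) (D : seq K -> nat -> set K) E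
    x a b g :
  (forall t : seq K,
    uniq t -> (forall c, c \in t -> c < sigma) -> (size t < m)%N) ->
  (forall c, c < g -> exists2 z, z < nu & c <= e g z /\ e g z < g) ->
  KK x -> x a -> x g -> b <= a -> a < g ->
  (forall c, x c -> b <= c -> c < g -> c = a) ->
  limit_pt E g -> (forall c, limit_pt E c -> E c) ->
  (forall s, words nu m s -> forall i, E `<=` D s i) ->
  (forall s i j, (i <= j)%N -> D s j `<=` D s i) ->
  (forall s i c, limit_pt (D s i) c -> D s i c) ->
  exists2 s, words nu m s & exists i,
    suc (below sigma) (post e s (D s i) x `\` below b) `<=` D s i.+1.
Proof.
move=> bound fcof Kx xa xg ba ag gap Elim Ecl ED Ddec Dcl.
have [s [sw sg sD]] := interleave m Elim fcof ag.
exists s => //.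
(* From [b] to [g] the only points of [x] are [a] and [g], so the expansion adds only points
   inserted for these two. *)
pose t := a :: g :: [seq e a z | z <- s] ++ [seq e g z | z <- s].
have tP h : expand e s x h -> b <= h -> h <= g -> h \in t.
  rewrite !inE mem_cat => -[xh bh|[g' [z [xg' zs -> hg' gap']]] bh].
    rewrite le_eqVlt => /orP[->|hg]; first by rewrite orbT.
    by rewrite (gap _ xh bh hg) eqxx.
  move=> hg; case: (ltgtP g' g) => [g'g|gg'|->].
  - rewrite (gap g') //; last exact: le_trans bh (ltW hg').
    by rewrite (map_f (fun z => e a z)) // !orbT.
  - by have := gap' _ xg gg'; rewrite ltNge hg.
  - by rewrite (map_f (fun z => e g z)) // !orbT.
have [i /(_ i (leqnn i)) stable] := floor_stable_seq t (Ddec s) (Dcl s).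
have Dg : D s i g by apply: ED => //; exact: Ecl.
have Xg : osup x g by exact: KK_sub_osup.
have Xlt c : c < g -> osup x c by move=> /ltW/osup_ordinal; apply.
(* The tail condition fails below [g], because [g] itself is in [D s i]. *)
have traceE c : c < g -> trace (D s i) (osup x) c <-> D s i c.
  move=> cg; split=> [[_ []//]|Dc]; last by split; [exact: Xlt|left].
  by move=> /(_ _ Dg Xg); rewrite leNgt cg.
exists i => c /suc_rank[[[Ec [h xh [ch hmax]]] bc] rc].
have {}bc : b <= c by rewrite leNgt; apply/negP.
(* The case [g <= c] is impossible: the [m] floors between [a] and [g] precede [c], so their ranks
   would be [m] distinct elements below [sigma]. *)
have [gc|cg] := leP g c.
  have [p [pm pp pq]] := sD _ (ED _ sw i) (Dcl s i).
  have pA q : q \in p -> (post e s (D s i) x `\` below b) q /\ q < c.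
    move=> qp; have [z zs [Dq qz qmax]] := pq _ qp.
    have /andP[az zg] := sg _ zs.
    have qg : q < g := le_lt_trans qz zg.
    have aq : a < q.
      by have /allP/(_ _ qp) := order_path_min lt_trans pp.
    split; last exact: lt_le_trans gc.
    split; last by apply/negP; rewrite -leNgt (le_trans ba) // ltW.
    split; first exact/traceE.
    exists (e g z); last first.
      split=> // d' Ed' d'z; apply: qmax => //.
      by apply/traceE => //; exact: le_lt_trans zg.
    right; exists g, z; split=> // c' xc' c'g.
    apply: le_lt_trans az; have [bc'|c'b] := leP b c'.
      by rewrite (gap _ xc' bc' c'g).
    exact: le_trans (ltW c'b) ba.
  set A := post _ _ _ _ `\` _ in pA rc.
  have : (size [seq rank wo A q | q <- p] < m)%N.
    apply: bound.
      rewrite map_inj_in_uniq.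
        by apply: lt_sorted_uniq; exact: path_sorted pp.
      by move=> q q' /pA[Aq _] /pA[Aq' _]; exact: rank_inj.
    move=> _ /mapP[q /pA[Aq qc] ->]; exact: lt_le_trans (rank_lt wo Aq qc) rc.
  by rewrite size_map pm ltnn.
(* A point above [g] would drop to [g] or beyond, as [g] is in the trace. *)
have hg : h <= g.
  rewrite leNgt; apply/negP => /ltW gh.
  by have := hmax _ (conj Xg (or_introl Dg)) gh; rewrite leNgt cg.
apply: (stable h); first exact: tP (le_trans bc ch) hg.
split=> //; first exact/(traceE _ cg).
move=> d' Dd' d'h; apply: hmax => //; split; last by left.
exact: osup_ordinal (le_trans d'h hg) Xg.
Qed.

End Guessing.

(** * The contradiction from iterated counterexamples *)

Lemma club_KK d (K : orderType d) (delta : K) (A : set K) :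
  below delta !=set0 -> club_in (below delta) A -> KK A /\ osup A = below delta.
Proof.
move=> [b0 b0d] [/closed_inE[Ad Acl] Aunb].
have unb b : b < delta -> exists2 a, A a & b < a.
  by move=> bd; have : osup A b by rewrite Aunb.
split=> //; apply/KK_E; split.
- by have [a] := unb _ b0d; exists a.
- by move=> a /Ad; exact: unb.
- by rewrite Aunb.
Qed.

Theorem theorem5p2 (d : Order.disp_t) (K : orderType d)
    (sigma nu : K) (xi S : set K) (J : K -> set (set K)) (C : K -> set K) :
  regular_uncountable K ->
  omega sigma -> is_cardinal (below sigma) ->
  omega `<=` below nu -> is_cardinal (below nu) ->
  is_ordinal xi ->
  S `<=` E_gt nu -> stationary S ->
  (forall delta, S delta ->
     [/\ proper_ideal (below delta) (J delta),
         additive (cof (below delta)) (J delta)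
       & Jbd delta `<=` J delta]) ->
  witnesses_CG xi S (E_le nu) ord_one J C ->
  exists2 Phi : set K -> set K,
    postprocessing_star Phi &
    witnesses_CG xi S [set: K] (below sigma) J (fun delta => Phi (C delta)).
Proof.
move=> [/well_order_least wo _ cofK _] sigma_fin _ nu_inf _ _ Snu _ JP.
move=> [Cseq Cbd Cguess].
have Jcomplete delta : S delta -> complete_family nu (J delta).
  move=> Sd; have [_ add _] := JP _ Sd.
  by apply: additive_complete add => //; have [] := Snu _ Sd.
have CK delta : S delta -> KK (C delta) /\ osup (C delta) = below delta.
  move=> Sd; apply: club_KK; last exact: Cseq.
  (* Properness of the ideal excludes [delta = 0]. *)
  have [[_ J0 _ _ nJ] _ _] := JP _ Sd; apply: contrapT => /nonemptyPn empty.
  by apply: nJ; rewrite empty.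
have /choice[e eP] : forall g, exists f : K -> K, E_le nu g ->
    forall b, b < g -> exists2 z, z < nu & b <= f z /\ f z < g.
  move=> g; have [/(E_le_cofinal_map wo)[f fP]|ng] := pselect (E_le nu g).
    by exists f.
  by exists id.
apply: contrapT => noPhi.
pose caught s D D' delta := [set b | b < delta /\
  suc (below sigma) (post e s D (C delta) `\` below b) `<=` D'].
(* The failure of [post e s D] yields a club [D'] for which all the [caught] sets are in the ideals;
   [setT] is the default when [D] is not club. *)
have /choice[refute refuteP] : forall sD : seq K * set K, exists D',
    club_in [set: K] sD.2 -> club_in [set: K] D' /\
    forall delta, S delta -> J delta (caught sD.1 sD.2 D' delta).
  move=> [s D] /=; have [Dclub|] := pselect (club_in [set: K] D); last first.
    by exists setT.
  have /club_inE[Dcl _] := Dclub.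
  apply: contrapT => nD'; apply: noPhi; exists (post e s D).
    exact: post_postprocessing.
  split=> [delta Sd|delta Sd|D' D'club].
  - by have [Kx <-] := CK _ Sd; exact: post_club.
  - have [Kx _] := CK _ Sd; apply: subset_trans (Cbd _ Sd); exact: post_otp.
  apply: contrapT => npos; apply: nD'; exists D' => _; split=> // delta Sd.
  apply: contrapT => nJ; apply: npos; exists delta => //.
  rewrite setIT; split=> //; by move=> b [].
pose Dn s := fix Dn i := if i is i'.+1 then Dn i' `&` refute (s, Dn i') else setT.
have Dclub s i : club_in [set: K] (Dn s i).
  elim: i => [|i IH] /=.
    by apply/club_inE; split=> // b; have [u uP] := index_bound wo cofK
      (fun _ : nat => b) (nat_le_nu nu_inf); exists u => //; exact: (uP 0%N).
  apply: (club_inI wo cofK nu_inf) => //.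
  by have [] := refuteP (s, Dn s i) IH.
have Ddec s i j : (i <= j)%N -> Dn s j `<=` Dn s i.
  move=> /subnK <-; elim: (j - i)%N => //= k IH a [/IH].
  by [].
have Dcl s i a : limit_pt (Dn s i) a -> Dn s i a.
  by have /club_inE[cl _] := Dclub s i; exact: cl.
have [m bound] := omega_bound sigma_fin.
have [E Eclub ED] : exists2 E, club_in [set: K] E &
    forall s, words nu m s -> forall i, E `<=` Dn s i.
  (* In terms of complements: their union over the words of length [m] and all [i] is nonstationary,
     and a club that avoids it is inside every [Dn s i]. *)
  have [|E Eclub ED] := @complete_words _ _ nu nonstationary m
      (fun s => \bigcup_(i in [set: nat]) ~` Dn s i)
      (nonstationary_complete wo cofK nu_inf).
    move=> s _; apply: (nonstationary_complete wo cofK nu_inf).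
      exact: nat_le_nu.
    by move=> i _; exists (Dn s i) => // a Da; apply.
  exists E => // s sw i a Ea; apply: contrapT => nD.
  by apply: (ED _ Ea); exists s => //; exists i.
(* A constant family gives a club of limit points of [E]. *)
have [E' E'club E'lim] := club_limits wo cofK nu_inf (nat_le_nu nu_inf)
  (fun _ _ => Eclub).
have [delta Sd [_ nJ]] := Cguess _ E'club; apply: nJ.
have [Kx xd] := CK _ Sd; have [[_ _ Jsub _ _] _ _] := JP _ Sd.
apply: (Jsub _ (\bigcup_(s in words nu m) \bigcup_(i in [set: nat])
    caught s (Dn s i) (Dn s i.+1) delta)).
  apply: complete_words => [|s _]; first exact: Jcomplete.
  apply: Jcomplete => // [|i _]; first exact: nat_le_nu.
  (* As [Dn s i.+1] is contained in the counterexample to [Dn s i], this set is contained in one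
     that is in [J delta]. *)
  have [_ /(_ _ Sd)] := refuteP (s, Dn s i) (Dclub s i).
  by move=> /Jsub; apply=> b [bd sub]; split=> // c /sub[].
move=> b [bd sub]; have /KK_E[_ nomax _] := Kx.
have [a1 xa1 ba1] : osup (C delta) b by rewrite xd.
(* The first two elements of [C delta] from [b] on are [a] and [g]; the guess concerns [g]. *)
have [|a [xa ba] amin] := wo [set c | C delta c /\ b <= c].
  by exists a1; split=> //; exact: ltW.
have [|g [xg ag] gmin] := wo [set c | C delta c /\ a < c].
  by have [c xc ac] := nomax _ xa; exists c.
have gap c : C delta c -> b <= c -> c < g -> c = a.
  move=> xc bc cg; apply/eqP; rewrite eq_le amin // andbT leNgt.
  by apply/negP => ac; have := gmin _ (conj xc ac); rewrite leNgt cg.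
have bnot c : ~ below b c <-> b <= c.
  by rewrite leNgt; split=> [/negP//|/negP].
have [E'g Eg] : (E' `&` E_le nu) g.
  apply: sub; apply: (suc_one wo (a := a)) => //.
  - by split=> //; exact/bnot.
  - by move=> c [xc /bnot bc]; exact: amin.
  - by split=> //; apply/bnot; exact: le_trans (ltW ag).
  - by move=> c [xc /bnot bc]; exact: gap.
have [||s sw [i si]] :=
  post_guess wo bound (eP _ Eg) Kx xa xg ba ag gap _ _ ED Ddec Dcl.
- exact: E'lim _ E'g 0%N Logic.I.
- by have /club_inE[] := Eclub.
by exists s => //; exists i.
Qed.
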